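(* Let $R$ be a region (without defects) consisting of $n$ cells. Then the region $R^{\boxplus}$ has a cover by L-trominoes if and only if $3\mid n$.
   Context: A cell is a unit square $[i,i+1]\times[j,j+1]$ with $i,j\in\mathbb{Z}$, labelled $(i,j)$. A region is a finite set of cells whose union is connected (equivalently, whose graph with edges between cells $(i,j),(i',j')$ with $|i-i'|+|j-j'|=1$ is connected). An L-tromino is a set of three cells equal to a $2\times 2$ block of cells with one cell removed (any of the four orientations). A cover of a region is a partition of it into L-trominoes. For a region $R$, $R^{\boxplus}$ is the region obtained by subdividing each cell into four cells, i.e. $R^{\boxplus}=\{(2i+s,2j+t): (i,j)\in R,\ s,t\in\{0,1\}\}$. *)

(* Defs.v *)
From Stdlib Require Import ZArith List Arith.
Import ListNotations.
Open Scope Z_scope.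

(* The cell [i,i+1]x[j,j+1] is labelled (i,j). *)
Definition cell : Type := (Z * Z)%type.

Definition adjacent (c d : cell) : Prop :=
  Z.abs (fst c - fst d) + Z.abs (snd c - snd d) = 1.

Inductive reach (S : cell -> Prop) : cell -> cell -> Prop :=
| reach_refl : forall c, S c -> reach S c c
| reach_step : forall c d e, reach S c d -> S e -> adjacent d e -> reach S c e.

Definition is_region (R : list cell) : Prop :=
  NoDup R /\ forall c d, In c R -> In d R -> reach (fun x => In x R) c d.

Definition in_block (i j : Z) (c : cell) : Prop :=
  i <= fst c <= i + 1 /\ j <= snd c <= j + 1.

Definition is_L_tromino (T : cell -> Prop) : Prop :=
  exists i j (m : cell), in_block i j m /\
    forall c, T c <-> (in_block i j c /\ c <> m).

Definition is_cover (S : cell -> Prop) (F : list (cell -> Prop)) : Prop :=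
  (forall T, In T F -> is_L_tromino T) /\
  (forall k l c, (k < l)%nat -> (l < length F)%nat ->
       nth k F (fun _ => False) c -> nth l F (fun _ => False) c -> False) /\
  (forall c, S c <-> exists T, In T F /\ T c).

Definition has_cover (S : cell -> Prop) : Prop := exists F, is_cover S F.

Definition subdiv (R : list cell) : cell -> Prop :=
  fun c => exists p s t, In p R /\ (s = 0 \/ s = 1) /\ (t = 0 \/ t = 1) /\
    c = (2 * fst p + s, 2 * snd p + t).

(* Main.v *)
(* The direct implication is counting: 4n cells are covered by trominoes of 3 cells.

   Conversely, orient the trominoes that straddle two blocks (subdivided cells of R) as a flow f along the edges of R, with values in Z/3: a value 1 from u to w means that a tromino takes one cell of u and the two cells of w facing u.  A block uses its remaining cells in a tromino of its own, or has none left, which forces f to have divergence 1 everywhere; since R is connected and 3 | n, such an f exists (send one unit from every cell to a fixed root).  Local obstructions come from two perpendicular incoming edges at a block w: they compete for the corner cell of w, so they are merged into one tromino made of this corner cell and one cell of each of the two neighbours.  Such a merge dictates which cell a neighbour u gives up, and u can comply as soon as the edge of u on the same side is inactive.  It is if f has the minimal number of nonzero values: adding a constant around a 2x2 square of cells then shows that every such square has at most two active edges. *)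

Require Import Defs.
From Stdlib Require Import ZArith List Arith Lia Bool Classical.
Import ListNotations.
Open Scope Z_scope.

Local Arguments Z.mul : simpl never.

(** * Covers *)

Lemma L_tromino_cells (T : cell -> Prop) : is_L_tromino T ->
  exists l, NoDup l /\ length l = 3%nat /\ forall c, T c <-> In c l.
Proof.
  intros (i & j & [a b] & [Ha Hb] & HT); simpl in Ha, Hb.
  assert (Hl : forall p q r : cell, p <> q -> p <> r -> q <> r -> NoDup [p; q; r]).
  { intros p q r H1 H2 H3.
    repeat constructor; simpl; intuition congruence. }
  assert (Ea : a = i \/ a = i + 1) by lia.
  assert (Eb : b = j \/ b = j + 1) by lia.
  (* As [a] is [i] or [i + 1], the other of the two is [2 * i + 1 - a]; likewise for [b]. *)
  exists [(2 * i + 1 - a, b); (a, 2 * j + 1 - b); (2 * i + 1 - a, 2 * j + 1 - b)].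
  split; [|split; [reflexivity|]].
  - apply Hl; intros E; injection E; lia.
  - intros [x y]; rewrite HT; unfold in_block; simpl; split.
    + intros [[Hx Hy] Hne].
      assert (~ (x = a /\ y = b)) by (intros [-> ->]; auto).
      assert (Ex : x = a \/ x = 2 * i + 1 - a) by lia.
      assert (Ey : y = b \/ y = 2 * j + 1 - b) by lia.
      destruct Ex as [-> | ->], Ey as [-> | ->]; tauto.
    + intros [[= <- <-] | [[= <- <-] | [[= <- <-] | []]]];
        (split; [lia | intros E; injection E; lia]).
Qed.

Lemma disjoint_family_cells (F : list (cell -> Prop)) :
  (forall T, In T F -> is_L_tromino T) ->
  (forall k l c, (k < l)%nat -> (l < length F)%nat ->
     nth k F (fun _ => False) c -> nth l F (fun _ => False) c -> False) ->
  exists L, NoDup L /\ length L = (3 * length F)%nat /\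
    forall c, In c L <-> exists T, In T F /\ T c.
Proof.
  induction F as [|T F IH]; intros HT Hd.
  - exists []; split; [constructor | split; [reflexivity|]].
    intros c; split; [intros [] | intros (T & [] & _)].
  - destruct IH as (L & HL & HlL & HLc).
    { intros; apply HT; now right. }
    { intros k l c Hkl Hl; apply (Hd (S k) (S l) c); simpl; lia. }
    destruct (L_tromino_cells T) as (M & HM & HlM & HMc); [apply HT; now left|].
    exists (M ++ L); split; [|split].
    + apply NoDup_app; auto.
      intros c Hc HcL. apply HLc in HcL as (U & HU & HUc).
      (* Disjointness is stated by positions in the list: [T] stands at 0 and [U] at [S n]. *)
      destruct (In_nth _ _ (fun _ => False) HU) as (n & Hn & <-).
      apply (Hd 0%nat (S n) c); simpl; auto; try lia. now apply HMc.
    + rewrite length_app; simpl; lia.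
    + intros c; rewrite in_app_iff, <- HMc, HLc; split.
      * intros [Hc | (U & HU & HUc)]; [exists T | exists U]; simpl; auto.
      * intros (U & [<- | HU] & HUc); [auto | right; eauto].
Qed.

Definition subdiv_list (R : list cell) : list cell :=
  flat_map (fun p => [(2 * fst p, 2 * snd p); (2 * fst p + 1, 2 * snd p);
    (2 * fst p, 2 * snd p + 1); (2 * fst p + 1, 2 * snd p + 1)]) R.

Lemma subdiv_iff (R : list cell) (x y : Z) :
  subdiv R (x, y) <-> In (x / 2, y / 2) R.
Proof.
  split.
  - intros ([i j] & s & t & Hp & Hs & Ht & [= -> ->]); simpl.
    replace ((2 * i + s) / 2) with i by (Z.div_mod_to_equations; lia).
    replace ((2 * j + t) / 2) with j by (Z.div_mod_to_equations; lia).
    exact Hp.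
  - intros H; exists (x / 2, y / 2), (x mod 2), (y mod 2); simpl.
    split; [exact H|].
    split; [Z.div_mod_to_equations; lia|].
    split; [Z.div_mod_to_equations; lia|].
    f_equal; Z.div_mod_to_equations; lia.
Qed.

Lemma in_subdiv_list (R : list cell) (c : cell) :
  In c (subdiv_list R) <-> subdiv R c.
Proof.
  unfold subdiv_list; rewrite in_flat_map; split.
  - intros ([i j] & Hp & Hc); simpl in Hc.
    destruct Hc as [<- | [<- | [<- | [<- | []]]]];
      [exists (i, j), 0, 0 | exists (i, j), 1, 0 | exists (i, j), 0, 1 | exists (i, j), 1, 1];
      simpl; rewrite ?Z.add_0_r; auto 6.
  - intros ([i j] & s & t & Hp & [-> | ->] & [-> | ->] & ->);
      exists (i, j); simpl; rewrite ?Z.add_0_r; auto 6.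
Qed.

Lemma length_subdiv_list (R : list cell) :
  length (subdiv_list R) = (4 * length R)%nat.
Proof. induction R as [|p R IH]; simpl in *; lia. Qed.

Lemma NoDup_subdiv_list (R : list cell) : NoDup R -> NoDup (subdiv_list R).
Proof.
  induction 1 as [|[i j] R Hp HR IH]; [constructor|].
  change (subdiv_list ((i, j) :: R)) with
    ([(2 * i, 2 * j); (2 * i + 1, 2 * j); (2 * i, 2 * j + 1); (2 * i + 1, 2 * j + 1)]
       ++ subdiv_list R).
  apply NoDup_app; auto.
  - repeat constructor; simpl; intuition (try congruence);
      match goal with H : (_, _) = (_, _) |- _ => injection H; intros; lia end.
  - intros [x y] Hc HcL; apply in_subdiv_list, subdiv_iff in HcL; apply Hp.
    replace (i, j) with (x / 2, y / 2); [exact HcL|].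
    simpl in Hc; destruct Hc as [[= <- <-] | [[= <- <-] | [[= <- <-] | [[= <- <-] | []]]]];
      f_equal; Z.div_mod_to_equations; lia.
Qed.

Lemma cover_divides (R : list cell) :
  NoDup R -> has_cover (subdiv R) -> Nat.divide 3 (length R).
Proof.
  intros HR (F & HT & Hd & HF).
  destruct (disjoint_family_cells F HT Hd) as (L & HL & HlL & HLc).
  assert (HE : forall c, In c L <-> In c (subdiv_list R)).
  { intros c; rewrite HLc, in_subdiv_list; symmetry; apply HF. }
  pose proof (NoDup_subdiv_list R HR) as HS.
  pose proof (NoDup_incl_length HL (fun c => proj1 (HE c))).
  pose proof (NoDup_incl_length HS (fun c => proj2 (HE c))).
  rewrite length_subdiv_list in *.
  (* With f trominoes and n cells, 3f = 4n gives n = 3(f - n). *)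
  exists (length F - length R)%nat; lia.
Qed.

(** The fibres of a function are disjoint and exhaustive by construction, so only their shape has to
    be checked. *)
Lemma cover_of_key (R : list cell) (key : cell -> cell) :
  (forall c, subdiv R c -> is_L_tromino (fun d => subdiv R d /\ key d = key c)) ->
  has_cover (subdiv R).
Proof.
  intros H.
  assert (eq_dec : forall c d : cell, {c = d} + {c <> d}).
  { decide equality; apply Z.eq_dec. }
  (* Removing duplicate keys lists each fibre once; a repeated fibre would overlap itself at two
     positions. *)
  set (K := nodup eq_dec (map key (subdiv_list R))).
  assert (HK : forall k, In k K <-> exists c, subdiv R c /\ key c = k).
  { intros k; unfold K; rewrite nodup_In, in_map_iff.
    split; intros (c & H1 & H2); exists c; [rewrite <- in_subdiv_list | rewrite in_subdiv_list]; auto. }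
  set (G := fun k d => subdiv R d /\ key d = k).
  exists (map G K); split; [|split].
  - intros T HT; apply in_map_iff in HT as (k & <- & Hk).
    apply HK in Hk as (c & Hc & <-); exact (H c Hc).
  - intros k l c Hkl Hl; rewrite length_map in Hl.
    rewrite !nth_indep with (d := fun _ => False) (d' := G (0, 0)) by (rewrite length_map; lia).
    rewrite !map_nth; intros [_ H1] [_ H2].
    assert (HN : NoDup K) by apply NoDup_nodup.
    enough (k = l) by lia.
    apply (proj1 (NoDup_nth K (0, 0)) HN); try lia; congruence.
  - intros c; split.
    + intros Hc; exists (G (key c)); split; [|now split].
      apply in_map_iff; exists (key c); split; auto; apply HK; eauto.
    + intros (T & HT & Hc); apply in_map_iff in HT as (k & <- & _); apply Hc.
Qed.

(** * Flows modulo 3 *)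

(** [eh i j] is the flow from (i,j) to (i+1,j) and [ev i j] the flow from (i,j) to (i,j+1). Integers
    stand for residues modulo 3, so an edge counts as used only when its residue is nonzero. *)
Definition supported (R : list cell) (eh ev : Z -> Z -> Z) : Prop :=
  forall i j, (eh i j mod 3 <> 0 -> In (i, j) R /\ In (i + 1, j) R) /\
              (ev i j mod 3 <> 0 -> In (i, j) R /\ In (i, j + 1) R).

Definition outflow (eh ev : Z -> Z -> Z) (i j : Z) : Z :=
  eh i j - eh (i - 1) j + (ev i j - ev i (j - 1)).

Definition dirac (c : cell) (i j : Z) : Z :=
  if (fst c =? i) && (snd c =? j) then 1 else 0.

Ltac dirac_solve :=
  unfold outflow, dirac in *; simpl in *;
  repeat match goal with |- context [?x =? ?y] => destruct (Z.eqb_spec x y) end;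
  simpl; lia.

Lemma supported_add (R : list cell) (eh ev eh' ev' : Z -> Z -> Z) :
  supported R eh ev -> supported R eh' ev' ->
  supported R (fun i j => eh i j + eh' i j) (fun i j => ev i j + ev' i j).
Proof.
  intros H H' i j; destruct (H i j) as [H1 H2], (H' i j) as [H1' H2']; split; intros Hn.
  - destruct (Z.eq_dec (eh i j mod 3) 0); [apply H1' | apply H1; auto].
    intros ?; apply Hn; rewrite Z.add_mod by lia; Z.div_mod_to_equations; lia.
  - destruct (Z.eq_dec (ev i j mod 3) 0); [apply H2' | apply H2; auto].
    intros ?; apply Hn; rewrite Z.add_mod by lia; Z.div_mod_to_equations; lia.
Qed.

Lemma flow_of_edge (R : list cell) (c d : cell) :
  In c R -> In d R -> adjacent c d -> exists eh ev, supported R eh ev /\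
    forall i j, outflow eh ev i j = dirac c i j - dirac d i j.
Proof.
  destruct c as [a b], d as [a' b']; unfold adjacent; simpl; intros Hc Hd Ha.
  assert (HH : forall k x y, In (x, y) R -> In (x + 1, y) R ->
    supported R (fun i j => k * dirac (x, y) i j) (fun _ _ => 0)).
  { intros k x y H1 H2 i j; unfold dirac; simpl.
    destruct (Z.eqb_spec x i), (Z.eqb_spec y j); simpl; rewrite ?Z.mul_0_r;
      subst; rewrite ?Zmod_0_l; tauto. }
  assert (HV : forall k x y, In (x, y) R -> In (x, y + 1) R ->
    supported R (fun _ _ => 0) (fun i j => k * dirac (x, y) i j)).
  { intros k x y H1 H2 i j; unfold dirac; simpl.
    destruct (Z.eqb_spec x i), (Z.eqb_spec y j); simpl; rewrite ?Z.mul_0_r;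
      subst; rewrite ?Zmod_0_l; tauto. }
  assert (E : a' = a + 1 /\ b' = b \/ a = a' + 1 /\ b' = b \/
              a' = a /\ b' = b + 1 \/ a' = a /\ b = b' + 1) by lia.
  destruct E as [[-> ->] | [[-> ->] | [[-> ->] | [-> ->]]]]; do 2 eexists.
  - split; [apply (HH 1 a b); auto | intros; dirac_solve].
  - split; [apply (HH (-1) a' b); auto | intros; dirac_solve].
  - split; [apply (HV 1 a b); auto | intros; dirac_solve].
  - split; [apply (HV (-1) a b'); auto | intros; dirac_solve].
Qed.

Lemma flow_of_reach (R : list cell) (c d : cell) :
  reach (fun x => In x R) c d -> exists eh ev, supported R eh ev /\
    forall i j, outflow eh ev i j = dirac c i j - dirac d i j.
Proof.
  induction 1 as [c Hc | c d e Hr (eh & ev & Hs & Ho) He Ha].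
  - exists (fun _ _ => 0), (fun _ _ => 0); split.
    + intros i j; rewrite Zmod_0_l; tauto.
    + intros; unfold outflow; lia.
  - assert (Hd : In d R) by (destruct Hr; auto).
    destruct (flow_of_edge R d e Hd He Ha) as (eh' & ev' & Hs' & Ho').
    do 2 eexists; split; [apply (supported_add _ _ _ _ _ Hs Hs')|].
    intros i j; specialize (Ho i j); specialize (Ho' i j).
    unfold outflow in *; lia.
Qed.

Definition zsum (g : cell -> Z) (l : list cell) : Z :=
  fold_right (fun c x => g c + x) 0 l.

Lemma zsum_add (g g' : cell -> Z) (l : list cell) :
  zsum (fun c => g c + g' c) l = zsum g l + zsum g' l.
Proof. induction l; simpl; lia. Qed.

Lemma zsum_mul (k : Z) (g : cell -> Z) (l : list cell) :
  zsum (fun c => k * g c) l = k * zsum g l.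
Proof. induction l; simpl; lia. Qed.

Lemma zsum_ext (g g' : cell -> Z) (l : list cell) :
  (forall c, g c = g' c) -> zsum g l = zsum g' l.
Proof. intros H; induction l; simpl; rewrite ?H; lia. Qed.

Lemma zsum_nonneg (g : cell -> Z) (l : list cell) :
  (forall c, 0 <= g c) -> 0 <= zsum g l.
Proof. intros H; induction l as [|c l IH]; simpl; [|specialize (H c)]; lia. Qed.

Lemma zsum_dirac_notin (i j : Z) (l : list cell) :
  ~ In (i, j) l -> zsum (fun c => dirac c i j) l = 0.
Proof.
  induction l as [|[a b] l IH]; simpl; intros H; [reflexivity|].
  rewrite IH by tauto; unfold dirac; simpl.
  destruct (Z.eqb_spec a i), (Z.eqb_spec b j); simpl; try lia; subst; tauto.
Qed.

Lemma zsum_dirac (i j : Z) (l : list cell) :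
  NoDup l -> In (i, j) l -> zsum (fun c => dirac c i j) l = 1.
Proof.
  induction 1 as [|[a b] l Hni Hn IH]; simpl; intros Hin; [easy|].
  unfold dirac at 1; simpl.
  destruct (Z.eqb_spec a i), (Z.eqb_spec b j); simpl; subst.
  1: now rewrite zsum_dirac_notin.
  all: destruct Hin as [E | Hin]; [injection E; lia | now rewrite IH].
Qed.

Lemma flow_to_sink (R : list cell) (r : cell) (l : list cell) :
  (forall c, In c l -> reach (fun x => In x R) c r) ->
  exists eh ev, supported R eh ev /\ forall i j,
    outflow eh ev i j = zsum (fun c => dirac c i j) l - Z.of_nat (length l) * dirac r i j.
Proof.
  induction l as [|c l IH]; intros H.
  - exists (fun _ _ => 0), (fun _ _ => 0); split.
    + intros i j; rewrite Zmod_0_l; tauto.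
    + intros; unfold outflow; simpl; lia.
  - destruct IH as (eh & ev & Hs & Ho); [intros; apply H; now right|].
    destruct (flow_of_reach R c r) as (eh' & ev' & Hs' & Ho'); [apply H; now left|].
    do 2 eexists; split; [apply (supported_add _ _ _ _ _ Hs Hs')|].
    intros i j; specialize (Ho i j); specialize (Ho' i j).
    cbn [length zsum fold_right]; rewrite Nat2Z.inj_succ.
    unfold outflow, zsum in *; lia.
Qed.

Definition unit_flow (R : list cell) (eh ev : Z -> Z -> Z) : Prop :=
  supported R eh ev /\ forall i j, In (i, j) R -> outflow eh ev i j mod 3 = 1.

(** When every cell sends one unit to the root [r], the outflow is 1 away from [r] and 1 - n at [r],
    which is 1 modulo 3 because 3 divides n. *)
Lemma unit_flow_exists (R : list cell) :
  is_region R -> Nat.divide 3 (length R) -> exists eh ev, unit_flow R eh ev.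
Proof.
  intros [HN HR] [k Hk]; destruct R as [|r R'].
  - exists (fun _ _ => 0), (fun _ _ => 0); split; [|intros ? ? []].
    intros i j; rewrite Zmod_0_l; tauto.
  - set (R := r :: R') in *.
    destruct (flow_to_sink R r R) as (eh & ev & Hs & Ho).
    { intros c Hc; apply HR; auto; now left. }
    exists eh, ev; split; auto; intros i j Hin.
    rewrite Ho, zsum_dirac, Hk, Nat2Z.inj_mul by auto.
    replace (1 - Z.of_nat k * Z.of_nat 3 * dirac r i j)
      with (1 + (- Z.of_nat k * dirac r i j) * 3) by lia.
    now rewrite Z_mod_plus_full.
Qed.

(** * Flows with few active edges *)

Definition active (z : Z) : Z := if z mod 3 =? 0 then 0 else 1.

Definition square_active (eh ev : Z -> Z -> Z) (i j : Z) : Z :=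
  active (eh i j) + active (eh i (j + 1)) + active (ev i j) + active (ev (i + 1) j).

(** Each edge is charged to its left or lower cell, so that an active edge of a supported flow is
    counted once. *)
Definition weight (R : list cell) (eh ev : Z -> Z -> Z) : Z :=
  zsum (fun c => active (eh (fst c) (snd c)) + active (ev (fst c) (snd c))) R.

Lemma active_add_mod (z k : Z) : active (z + k) = active (z mod 3 + k).
Proof. unfold active; now rewrite Zplus_mod_idemp_l. Qed.

Lemma active_cases (z : Z) : active z = 0 \/ active z = 1 /\ z mod 3 <> 0.
Proof. unfold active; destruct (Z.eqb_spec (z mod 3) 0); auto. Qed.

(* Going around the square, the four values are a, d, -b, -c; subtracting the most frequent one from all of them maximizes the number of zeros. *)
Lemma square_shift (a b c d : Z) :
  2 < active a + active b + active c + active d -> exists k,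
  active (a + - k) + active (b + k) + active (c + k) + active (d + - k)
    < active a + active b + active c + active d.
Proof.
  assert (H0 : forall z, active z = active (z mod 3)).
  { intros z; unfold active; now rewrite Z.mod_mod by lia. }
  assert (Hm : forall z, z mod 3 = 0 \/ z mod 3 = 1 \/ z mod 3 = 2).
  { intros z; pose proof (Z.mod_pos_bound z 3); lia. }
  rewrite (H0 a), (H0 b), (H0 c), (H0 d).
  setoid_rewrite (active_add_mod a); setoid_rewrite (active_add_mod b).
  setoid_rewrite (active_add_mod c); setoid_rewrite (active_add_mod d).
  destruct (Hm a) as [-> | [-> | ->]], (Hm b) as [-> | [-> | ->]],
    (Hm c) as [-> | [-> | ->]], (Hm d) as [-> | [-> | ->]];
    intros H; try (exfalso; revert H; vm_compute; discriminate);
    solve [exists 1; vm_compute; reflexivity | exists 2; vm_compute; reflexivity].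
Qed.

(** A constant circulation around the square leaves every outflow unchanged and alters only its four
    edges. *)
Lemma unit_flow_reduce (R : list cell) (eh ev : Z -> Z -> Z) (i j : Z) :
  NoDup R -> unit_flow R eh ev -> 2 < square_active eh ev i j ->
  exists eh' ev', unit_flow R eh' ev' /\ weight R eh' ev' < weight R eh ev.
Proof.
  intros HN [Hs Ho] Hq.
  (* Three active edges of a square touch all four of its cells, so the circulation stays inside
     [R]. *)
  assert (HI : (In (i, j) R /\ In (i + 1, j) R) /\ In (i, j + 1) R /\ In (i + 1, j + 1) R).
  { destruct (Hs i j) as [H1 H2], (Hs i (j + 1)) as [H3 _], (Hs (i + 1) j) as [_ H4].
    unfold square_active in Hq.
    destruct (active_cases (eh i j)) as [E1 | [E1 N1]],
      (active_cases (eh i (j + 1))) as [E2 | [E2 N2]],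
      (active_cases (ev i j)) as [E3 | [E3 N3]],
      (active_cases (ev (i + 1) j)) as [E4 | [E4 N4]]; try lia; tauto. }
  destruct HI as [[I1 I2] [I3 I4]].
  destruct (square_shift _ _ _ _ Hq) as [k Hk].
  exists (fun x y => eh x y + - k * dirac (i, j) x y + k * dirac (i, j + 1) x y).
  exists (fun x y => ev x y + k * dirac (i, j) x y + - k * dirac (i + 1, j) x y).
  split; [split|].
  - intros x y; destruct (Hs x y) as [H1 H2]; unfold dirac; simpl.
    destruct (Z.eqb_spec i x), (Z.eqb_spec j y), (Z.eqb_spec (j + 1) y), (Z.eqb_spec (i + 1) x);
      try lia; simpl; subst; rewrite ?Z.mul_0_r, ?Z.add_0_r; tauto.
  - intros x y Hin; etransitivity; [|exact (Ho x y Hin)]; f_equal; dirac_solve.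
  - set (D1 := active (eh i j + - k) - active (eh i j) + (active (ev i j + k) - active (ev i j))).
    set (D2 := active (ev (i + 1) j + - k) - active (ev (i + 1) j)).
    set (D3 := active (eh i (j + 1) + k) - active (eh i (j + 1))).
    enough (E : weight R (fun x y => eh x y + - k * dirac (i, j) x y + k * dirac (i, j + 1) x y)
        (fun x y => ev x y + k * dirac (i, j) x y + - k * dirac (i + 1, j) x y)
      = weight R eh ev + (D1 * zsum (fun c => dirac c i j) R +
         (D2 * zsum (fun c => dirac c (i + 1) j) R + D3 * zsum (fun c => dirac c i (j + 1)) R))).
    { rewrite E, !zsum_dirac by auto; unfold D1, D2, D3; lia. }
    unfold weight; rewrite <- !zsum_mul, <- !zsum_add.
    apply zsum_ext; intros [x y]; unfold dirac, D1, D2, D3; simpl.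
    rewrite (Z.eqb_sym x i), (Z.eqb_sym y j), (Z.eqb_sym x (i + 1)), (Z.eqb_sym y (j + 1)).
    destruct (Z.eqb_spec i x), (Z.eqb_spec j y), (Z.eqb_spec (j + 1) y), (Z.eqb_spec (i + 1) x);
      try lia; simpl; subst; rewrite ?Z.mul_0_r, ?Z.mul_1_r, ?Z.add_0_r; lia.
Qed.

Lemma sparse_unit_flow_exists (R : list cell) :
  is_region R -> Nat.divide 3 (length R) ->
  exists eh ev, unit_flow R eh ev /\ forall i j, square_active eh ev i j <= 2.
Proof.
  intros HR Hd; destruct (unit_flow_exists R HR Hd) as (eh & ev & Hf).
  (* Descent on the weight, run as an induction on a natural upper bound; at bound 0 a further
     decrease would make a weight negative. *)
  assert (Hw : exists n, weight R eh ev <= Z.of_nat n).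
  { exists (Z.to_nat (weight R eh ev)); lia. }
  destruct Hw as [n Hn]; revert eh ev Hf Hn.
  induction n as [|n IH]; intros eh ev Hf Hn.
  all: destruct (classic (exists i j, 2 < square_active eh ev i j)) as [(i & j & Hq) | Hq];
    [|exists eh, ev; split; [exact Hf|]; intros i j; apply Z.le_ngt; eauto].
  all: destruct (unit_flow_reduce R eh ev i j) as (eh' & ev' & Hf' & Hlt); auto; try apply HR.
  - assert (0 <= weight R eh' ev'); [|lia].
    apply zsum_nonneg; intros c.
    destruct (active_cases (eh' (fst c) (snd c))) as [? | []],
      (active_cases (ev' (fst c) (snd c))) as [? | []]; lia.
  - apply (IH eh' ev'); auto; lia.
Qed.

(** * Local rules at a block *)

Inductive trit : Type := Idle | Give | Take.

Definition opp (x : trit) : trit :=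
  match x with Idle => Idle | Give => Take | Take => Give end.

Definition val (x : trit) : Z :=
  match x with Idle => 0 | Give => 1 | Take => -1 end.

Definition trit_of (z : Z) : trit :=
  match z mod 3 with 0 => Idle | 1 => Give | _ => Take end.

Lemma trit_of_opp (z : Z) : trit_of (- z) = opp (trit_of z).
Proof.
  unfold trit_of; pose proof (Z.mod_pos_bound z 3).
  assert (E : z mod 3 = 0 \/ z mod 3 = 1 \/ z mod 3 = 2) by lia.
  assert (E' : (- z) mod 3 = (- (z mod 3)) mod 3).
  { rewrite <- (Z.sub_0_l z), <- (Z.sub_0_l (z mod 3)); now rewrite Zminus_mod_idemp_r. }
  rewrite E'; destruct E as [-> | [-> | ->]]; reflexivity.
Qed.

Lemma val_trit_of (z : Z) : exists k, z = val (trit_of z) + 3 * k.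
Proof.
  unfold trit_of; pose proof (Z.mod_pos_bound z 3).
  assert (E : z mod 3 = 0 \/ z mod 3 = 1 \/ z mod 3 = 2) by lia.
  pose proof (Z_div_mod_eq_full z 3) as Ez.
  destruct E as [E | [E | E]]; rewrite E in Ez |- *; cbn [val];
    [exists (z / 3) | exists (z / 3) | exists (z / 3 + 1)]; lia.
Qed.

Lemma trit_of_active (z : Z) : trit_of z <> Idle -> z mod 3 <> 0.
Proof. unfold trit_of; intros H E; rewrite E in H; auto. Qed.

(** A [Give] side costs the block one cell and a [Take] side two, that is -1 modulo 3. A total of 1
    therefore leaves a multiple of 3 among the four cells. A merge costs 1 instead of 2 + 2, the
    same modulo 3. *)
Definition balanced (h v : bool -> trit) : bool :=
  (val (h true) + val (h false) + val (v true) + val (v false)) mod 3 =? 1.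

(* [h] and [v] are the flows leaving a block through its two vertical and its two horizontal sides ([true] being right and up); the pair [(s, t)] is a corner of the block.  [merge h v s t]: this corner forms a tromino with the neighbouring cells of both adjacent blocks, which are incoming. *)
Definition merge (h v : bool -> trit) (s t : bool) : bool :=
  match h s, v t with
  | Take, Take =>
      match h (negb s), v (negb t) with
      | Idle, Idle => true
      | Give, Take => negb t
      | Take, Give => negb s
      | _, _ => false
      end
  | _, _ => false
  end.

(* Corner [(s, t)] is covered together with cells across the side [s] of direction [a], [b] being the perpendicular direction.  An outgoing side gives up the one of its two cells that the perpendicular sides do not need; [r] breaks the cyclic symmetry when all sides are outgoing, and [q] is used when there is no perpendicular constraint. *)
Definition give (r : bool) (a b : bool -> trit) (q s t : bool) : bool :=
  match a s with
  | Idle => false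
  | Take => negb (merge a b s true || merge a b s false)
  | Give =>
      Bool.eqb t
        match b true, b false with
        | Take, _ => false
        | _, Take => true
        | Give, Give => xorb r s
        | Give, Idle => false
        | Idle, Give => true
        | Idle, Idle => q
        end
  end.

(** The rules inspect only four side values and some booleans, so every claim about a single block
    is a finite check. *)
Ltac local_cases h v :=
  repeat match goal with x : bool |- _ => destruct x end;
  unfold give, merge, balanced; cbn [negb];
  destruct (h true), (h false), (v true), (v false); vm_compute;
  intuition discriminate.

(** No cell is claimed twice. When all four sides give, [r] being [false] for [h] and [true] for [v]
    produces a pinwheel: right, up, left and down give the upper right, upper left, lower left and
    lower right cells. *)
Lemma roles_exclusive (h v : bool -> trit) (q s t : bool) : balanced h v = true ->
  (merge h v s t = true -> give false h v q s t = false /\ give true v h q t s = false) /\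
  (give false h v q s t = true -> give true v h q t s = false).
Proof. local_cases h v. Qed.

Definition own (h v : bool -> trit) (q s t : bool) : bool :=
  negb (merge h v s t || give false h v q s t || give true v h q t s).

Definition zero_or_three (a b c d : bool) : bool :=
  let n := (Z.b2z a + Z.b2z b + Z.b2z c + Z.b2z d)%Z in (n =? 0) || (n =? 3).

Lemma zero_or_three_swap (a b c d : bool) : zero_or_three a b c d = zero_or_three c d a b.
Proof. now destruct a, b, c, d. Qed.

Lemma zero_or_three_middle (a b c d : bool) : zero_or_three a b c d = zero_or_three a c b d.
Proof. now destruct a, b, c, d. Qed.

Lemma own_count (h v : bool -> trit) (q : bool) : balanced h v = true ->
  zero_or_three (own h v q false false) (own h v q false true)
    (own h v q true false) (own h v q true true) = true.
Proof. unfold own; local_cases h v. Qed.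

Lemma merge_swap (h v : bool -> trit) (s t : bool) : merge v h t s = merge h v s t.
Proof. local_cases h v. Qed.

Lemma balanced_swap (h v : bool -> trit) : balanced v h = balanced h v.
Proof. unfold balanced; do 2 f_equal; lia. Qed.

Lemma merge_take (h v : bool -> trit) (s t : bool) :
  merge h v s t = true -> h s = Take /\ v t = Take.
Proof. unfold merge; destruct (h s), (v t); auto; discriminate. Qed.

(** Both ends of a side can compete only when three sides are incoming, and [merge] then selects the
    lower or left corner. *)
Lemma merge_unique (h v : bool -> trit) (s t : bool) :
  merge h v s t = true -> merge h v s (negb t) = false.
Proof. local_cases h v. Qed.

(** If the other perpendicular side is active, the rule already selects the cell at [t], away from a
    [Take] or from the cell left to a [Give]. If it is idle, balance makes the opposite side idle
    too, and [q] decides. *)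
Lemma give_forced (r : bool) (a b : bool -> trit) (q s t : bool) :
  balanced a b = true -> a s = Give -> b t = Idle ->
  give r a b q s t = true \/
  a (negb s) = Idle /\ b (negb t) = Idle /\ give r a b q s t = Bool.eqb t q.
Proof. local_cases a b. Qed.

Lemma give_side_count (r : bool) (a b : bool -> trit) (q s : bool) :
  a s = Give -> give r a b q s false = negb (give r a b q s true).
Proof. unfold give; intros ->; now destruct (match b true with Idle => _ | _ => _ end). Qed.

(** * Assigning a window to each cell *)

Definition step (s : bool) : Z := if s then 1 else -1.

Definition hor (eh : Z -> Z -> Z) (i j : Z) (s : bool) : trit :=
  trit_of (if s then eh i j else - eh (i - 1) j).

Definition ver (ev : Z -> Z -> Z) (i j : Z) (t : bool) : trit :=
  trit_of (if t then ev i j else - ev i (j - 1)).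

Definition merges (eh ev : Z -> Z -> Z) (i j : Z) : bool -> bool -> bool :=
  merge (hor eh i j) (ver ev i j).

(* When a block has a single active side, [true] iff the block across that side has merged at the corner that forces the upper (resp. right) cell to be given. *)
Definition prefers (eh ev : Z -> Z -> Z) (i j : Z) : bool :=
  merges eh ev (i + 1) j false true || merges eh ev (i - 1) j true true ||
  merges eh ev i (j + 1) true false || merges eh ev i (j - 1) true true.

Definition gives_h (eh ev : Z -> Z -> Z) (i j : Z) (s t : bool) : bool :=
  give false (hor eh i j) (ver ev i j) (prefers eh ev i j) s t.

Definition gives_v (eh ev : Z -> Z -> Z) (i j : Z) (s t : bool) : bool :=
  give true (ver ev i j) (hor eh i j) (prefers eh ev i j) t s.

(** The last disjunct is a cell given vertically to a neighbour that merges it: that tromino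
    surrounds a common vertex of four blocks, so its window is also shifted horizontally. *)
Definition leaves_h (eh ev : Z -> Z -> Z) (i j : Z) (s t : bool) : bool :=
  merges eh ev i j s t || gives_h eh ev i j s t ||
  gives_v eh ev i j s t && merges eh ev i (j + step t) s (negb t).

Definition leaves_v (eh ev : Z -> Z -> Z) (i j : Z) (s t : bool) : bool :=
  merges eh ev i j s t || gives_v eh ev i j s t ||
  gives_h eh ev i j s t && merges eh ev (i + step s) j (negb s) t.

(* The lower left corner of the 2x2 window containing the tromino of a cell. *)
Definition window (eh ev : Z -> Z -> Z) (c : cell) : cell :=
  let i := fst c / 2 in let j := snd c / 2 in
  let s := Z.odd (fst c) in let t := Z.odd (snd c) in
  (2 * i + (if leaves_h eh ev i j s t then step s else 0),
   2 * j + (if leaves_v eh ev i j s t then step t else 0)).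

(** The flags [a] and [b] are the type of the window: inside one block, across one side, or around a
    vertex when both are [true]. *)
Definition hits (eh ev : Z -> Z -> Z) (i j : Z) (s t a b : bool) : bool :=
  Bool.eqb (leaves_h eh ev i j s t) a && Bool.eqb (leaves_v eh ev i j s t) b.

Lemma hor_opp (eh : Z -> Z -> Z) (i j : Z) (s : bool) :
  hor eh (i + step s) j (negb s) = opp (hor eh i j s).
Proof.
  unfold hor; destruct s; simpl.
  - now rewrite trit_of_opp, Z.add_simpl_r.
  - now rewrite trit_of_opp; destruct (trit_of _).
Qed.

Lemma ver_opp (ev : Z -> Z -> Z) (i j : Z) (t : bool) :
  ver ev i (j + step t) (negb t) = opp (ver ev i j t).
Proof.
  unfold ver; destruct t; simpl.
  - now rewrite trit_of_opp, Z.add_simpl_r.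
  - now rewrite trit_of_opp; destruct (trit_of _).
Qed.

Lemma hor_in (R : list cell) (eh ev : Z -> Z -> Z) (i j : Z) (s : bool) :
  supported R eh ev -> hor eh i j s <> Idle -> In (i, j) R.
Proof.
  unfold hor; intros Hs; destruct s; [|rewrite trit_of_opp]; intros Hn.
  - apply (proj1 (Hs i j)), trit_of_active, Hn.
  - replace i with (i - 1 + 1) by lia; apply (proj1 (Hs (i - 1) j)), trit_of_active.
    intros E; rewrite E in Hn; auto.
Qed.

Lemma ver_in (R : list cell) (eh ev : Z -> Z -> Z) (i j : Z) (t : bool) :
  supported R eh ev -> ver ev i j t <> Idle -> In (i, j) R.
Proof.
  unfold ver; intros Hs; destruct t; [|rewrite trit_of_opp]; intros Hn.
  - apply (proj2 (Hs i j)), trit_of_active, Hn.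
  - replace j with (j - 1 + 1) by lia; apply (proj2 (Hs i (j - 1))), trit_of_active.
    intros E; rewrite E in Hn; auto.
Qed.

Lemma balanced_in (R : list cell) (eh ev : Z -> Z -> Z) (i j : Z) :
  unit_flow R eh ev -> In (i, j) R -> balanced (hor eh i j) (ver ev i j) = true.
Proof.
  intros [_ Ho] Hin; specialize (Ho i j Hin); unfold balanced, hor, ver, outflow in *.
  apply Z.eqb_eq; etransitivity; [|exact Ho].
  destruct (val_trit_of (eh i j)) as [k1 E1], (val_trit_of (- eh (i - 1) j)) as [k2 E2],
    (val_trit_of (ev i j)) as [k3 E3], (val_trit_of (- ev i (j - 1))) as [k4 E4].
  replace (eh i j - eh (i - 1) j + (ev i j - ev i (j - 1))) with
    (val (trit_of (eh i j)) + val (trit_of (- eh (i - 1) j)) + val (trit_of (ev i j)) +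
     val (trit_of (- ev i (j - 1))) + (k1 + k2 + k3 + k4) * 3) by lia.
  now rewrite Z_mod_plus_full.
Qed.

Definition sparse (eh ev : Z -> Z -> Z) : Prop :=
  forall i j, square_active eh ev i j <= 2.

Definition busy (x : trit) : Z := match x with Idle => 0 | _ => 1 end.

Lemma busy_trit_of (z : Z) : busy (trit_of z) = active z /\ busy (trit_of (- z)) = active z.
Proof.
  rewrite trit_of_opp; unfold trit_of, active; pose proof (Z.mod_pos_bound z 3).
  assert (E : z mod 3 = 0 \/ z mod 3 = 1 \/ z mod 3 = 2) by lia.
  destruct E as [-> | [-> | ->]]; auto.
Qed.

(** These are the four edges of the 2x2 square of cells around the corner (s,t) of the block
    (i,j). *)
Lemma sparse_corner (eh ev : Z -> Z -> Z) (i j : Z) (s t : bool) : sparse eh ev ->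
  busy (hor eh i j s) + busy (ver ev i j t) +
  busy (hor eh i (j + step t) s) + busy (ver ev (i + step s) j t) <= 2.
Proof.
  intros Hq.
  specialize (Hq (if s then i else i - 1) (if t then j else j - 1)).
  unfold square_active, hor, ver in *.
  destruct s, t; simpl step; change (i + -1) with (i - 1); change (j + -1) with (j - 1);
    rewrite ?(proj2 (busy_trit_of _)), ?(proj1 (busy_trit_of _)); rewrite ?Z.sub_add in Hq; lia.
Qed.

(* A merging neighbour occupies two sides of the square around the corner, so sparsity keeps the other side of this block idle. *)
Lemma merge_gives_h (R : list cell) (eh ev : Z -> Z -> Z) (i j : Z) (s t : bool) :
  unit_flow R eh ev -> sparse eh ev ->
  merges eh ev (i + step s) j (negb s) t = true -> gives_h eh ev i j s t = true.
Proof.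
  intros Hf Hq Hm; pose proof (merge_take _ _ _ _ Hm) as [Hh Hv].
  rewrite hor_opp in Hh.
  assert (Eh : hor eh i j s = Give) by (destruct (hor eh i j s); easy).
  assert (Ev : ver ev i j t = Idle).
  { pose proof (sparse_corner eh ev i j s t Hq) as H.
    rewrite Eh, Hv in H; destruct (ver ev i j t), (hor eh i (j + step t) s); simpl in H; auto; lia. }
  assert (Hb : balanced (hor eh i j) (ver ev i j) = true).
  { apply (balanced_in R); auto; apply (hor_in R eh ev i j s); [apply Hf | congruence]. }
  unfold gives_h.
  destruct (give_forced false _ _ (prefers eh ev i j) s t Hb Eh Ev) as [E | (E1 & E2 & ->)]; auto.
  (* The active side is the only one left, so no neighbour across another side can merge towards
     this block, and [prefers] reads off the corner chosen by the single candidate. *)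
  apply eqb_true_iff; unfold prefers, merges in *.
  assert (N : forall i' j' a b, hor eh i' j' a <> Take \/ ver ev i' j' b <> Take ->
    merge (hor eh i' j') (ver ev i' j') a b = false).
  { intros i' j' a b Hn; apply not_true_is_false; intros H.
    apply merge_take in H as [? ?]; tauto. }
  pose proof (ver_opp ev i j true) as O1; pose proof (ver_opp ev i j false) as O2.
  pose proof (hor_opp eh i j (negb s)) as O3; rewrite E1, negb_involutive in O3.
  assert (V : ver ev i j true = Idle /\ ver ev i j false = Idle) by (destruct t; auto).
  destruct V as [V1 V2]; rewrite V1 in O1; rewrite V2 in O2; simpl in O1, O2, O3.
  change (j + -1) with (j - 1) in O2.
  rewrite (N i (j + 1) true false), (N i (j - 1) true true) by
    (right; rewrite ?O1, ?O2; discriminate).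
  destruct s; simpl in Hm, O3.
  - change (i + -1) with (i - 1) in O3.
    rewrite (N (i - 1) j true true) by (left; rewrite O3; discriminate).
    destruct t; [now rewrite Hm|].
    apply merge_unique in Hm; simpl in Hm; now rewrite Hm.
  - rewrite (N (i + 1) j false true) by (left; rewrite O3; discriminate).
    change (i + -1) with (i - 1) in Hm.
    destruct t; [now rewrite Hm|].
    apply merge_unique in Hm; simpl in Hm; now rewrite Hm.
Qed.

(** The horizontal argument with the axes exchanged; [merge_swap] transfers [merge_unique] to the
    two corners of a horizontal side. *)
Lemma merge_gives_v (R : list cell) (eh ev : Z -> Z -> Z) (i j : Z) (s t : bool) :
  unit_flow R eh ev -> sparse eh ev ->
  merges eh ev i (j + step t) s (negb t) = true -> gives_v eh ev i j s t = true.
Proof.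
  intros Hf Hq Hm; pose proof (merge_take _ _ _ _ Hm) as [Hh Hv].
  rewrite ver_opp in Hv.
  assert (Ev : ver ev i j t = Give) by (destruct (ver ev i j t); easy).
  assert (Eh : hor eh i j s = Idle).
  { pose proof (sparse_corner eh ev i j s t Hq) as H.
    rewrite Ev, Hh in H; destruct (hor eh i j s), (ver ev (i + step s) j t); simpl in H; auto; lia. }
  assert (Hb : balanced (ver ev i j) (hor eh i j) = true).
  { assert (Hin : In (i, j) R) by
      (apply (ver_in R eh ev i j t); [apply Hf | congruence]).
    rewrite balanced_swap; exact (balanced_in R eh ev i j Hf Hin). }
  unfold gives_v.
  destruct (give_forced true _ _ (prefers eh ev i j) t s Hb Ev Eh) as [E | (E1 & E2 & ->)]; auto.
  apply eqb_true_iff; unfold prefers, merges in *.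
  assert (N : forall i' j' a b, hor eh i' j' a <> Take \/ ver ev i' j' b <> Take ->
    merge (hor eh i' j') (ver ev i' j') a b = false).
  { intros i' j' a b Hn; apply not_true_is_false; intros H.
    apply merge_take in H as [? ?]; tauto. }
  pose proof (hor_opp eh i j true) as O1; pose proof (hor_opp eh i j false) as O2.
  pose proof (ver_opp ev i j (negb t)) as O3; rewrite E1, negb_involutive in O3.
  assert (V : hor eh i j true = Idle /\ hor eh i j false = Idle) by (destruct s; auto).
  destruct V as [V1 V2]; rewrite V1 in O1; rewrite V2 in O2; simpl in O1, O2, O3.
  change (i + -1) with (i - 1) in O2.
  rewrite (N (i + 1) j false true), (N (i - 1) j true true) by
    (left; rewrite ?O1, ?O2; discriminate).
  rewrite <- merge_swap in Hm.
  destruct t; simpl in Hm, O3.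
  - change (j + -1) with (j - 1) in O3.
    rewrite (N i (j - 1) true true) by (right; rewrite O3; discriminate).
    destruct s; [rewrite merge_swap in Hm; now rewrite Hm|].
    apply merge_unique in Hm; rewrite merge_swap in Hm; simpl in Hm; now rewrite Hm.
  - rewrite (N i (j + 1) true false) by (right; rewrite O3; discriminate).
    change (j + -1) with (j - 1) in Hm.
    destruct s; [rewrite merge_swap in Hm; now rewrite Hm|].
    apply merge_unique in Hm; rewrite merge_swap in Hm; simpl in Hm; now rewrite Hm.
Qed.

(** Outside [R] there is no balance to invoke, but there the support condition makes the sides
    idle. *)
Lemma roles_exclusive_all (R : list cell) (eh ev : Z -> Z -> Z) (i j : Z) (s t : bool) :
  unit_flow R eh ev ->
  (merges eh ev i j s t = true -> gives_h eh ev i j s t = false /\ gives_v eh ev i j s t = false) /\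
  (gives_h eh ev i j s t = true -> gives_v eh ev i j s t = false).
Proof.
  intros Hf; destruct (classic (In (i, j) R)) as [Hin | Hout].
  - apply roles_exclusive, (balanced_in R eh ev i j Hf Hin).
  - assert (Eh : hor eh i j s = Idle).
    { destruct (hor eh i j s) eqn:E; auto; destruct Hout;
        apply (hor_in R eh ev i j s); try apply Hf; congruence. }
    unfold merges, gives_h, gives_v, merge, give; rewrite Eh.
    split; discriminate.
Qed.
Lemma cell_eq_iff (a b x y : Z) : ((a, b) : cell) = (x, y) <-> a = x /\ b = y.
Proof. apply pair_equal_spec. Qed.

(** * Counting the cells of a window *)

Lemma hits_block (eh ev : Z -> Z -> Z) (i j : Z) (s t : bool) :
  hits eh ev i j s t false false = own (hor eh i j) (ver ev i j) (prefers eh ev i j) s t.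
Proof.
  unfold hits, leaves_h, leaves_v, own, gives_h, gives_v, merges.
  destruct (merge _ _ s t), (give false _ _ _ _ _), (give true _ _ _ _ _); simpl;
    rewrite ?andb_false_r; reflexivity.
Qed.

(** A cell wanted by a merge across the side moves to a vertex window; what remains across the side
    alone is the unmerged tromino. *)
Lemma hits_edge_h (R : list cell) (eh ev : Z -> Z -> Z) (i j : Z) (s t : bool) :
  unit_flow R eh ev -> hits eh ev i j s t true false =
    gives_h eh ev i j s t && negb (merges eh ev (i + step s) j (negb s) t).
Proof.
  intros Hf; pose proof (roles_exclusive_all R eh ev i j s t Hf) as [H1 H2].
  unfold hits, leaves_h, leaves_v.
  destruct (merges eh ev i j s t), (gives_h eh ev i j s t), (gives_v eh ev i j s t); simpl;
    repeat match goal with |- context [merges ?a ?b ?c ?d ?e ?f] =>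
      destruct (merges a b c d e f) end; simpl; intuition (try discriminate).
Qed.

Lemma hits_edge_v (R : list cell) (eh ev : Z -> Z -> Z) (i j : Z) (s t : bool) :
  unit_flow R eh ev -> hits eh ev i j s t false true =
    gives_v eh ev i j s t && negb (merges eh ev i (j + step t) s (negb t)).
Proof.
  intros Hf; pose proof (roles_exclusive_all R eh ev i j s t Hf) as [H1 H2].
  unfold hits, leaves_h, leaves_v.
  destruct (merges eh ev i j s t), (gives_h eh ev i j s t), (gives_v eh ev i j s t); simpl;
    repeat match goal with |- context [merges ?a ?b ?c ?d ?e ?f] =>
      destruct (merges a b c d e f) end; simpl; intuition (try discriminate).
Qed.

Lemma hits_corner (R : list cell) (eh ev : Z -> Z -> Z) (i j : Z) (s t : bool) :
  unit_flow R eh ev -> hits eh ev i j s t true true =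
    merges eh ev i j s t ||
    gives_h eh ev i j s t && merges eh ev (i + step s) j (negb s) t ||
    gives_v eh ev i j s t && merges eh ev i (j + step t) s (negb t).
Proof.
  intros Hf; pose proof (roles_exclusive_all R eh ev i j s t Hf) as [H1 H2].
  unfold hits, leaves_h, leaves_v.
  destruct (merges eh ev i j s t), (gives_h eh ev i j s t), (gives_v eh ev i j s t); simpl;
    repeat match goal with |- context [merges ?a ?b ?c ?d ?e ?f] =>
      destruct (merges a b c d e f) end; simpl; intuition (try discriminate).
Qed.

(** Across an active side, either the receiver does not merge there and contributes two cells to the
    one given, or it merges and the given cell, forced to be the merging corner, leaves for a vertex
    window. The hypothesis on [hor] makes (i,j) the giver. *)
Lemma edge_count_h (R : list cell) (eh ev : Z -> Z -> Z) (i i' j : Z) (s : bool) :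
  unit_flow R eh ev -> sparse eh ev -> i' = i + step s -> hor eh i j s <> Take ->
  zero_or_three (hits eh ev i j s false true false) (hits eh ev i j s true true false)
    (hits eh ev i' j (negb s) false true false) (hits eh ev i' j (negb s) true true false) = true.
Proof.
  intros Hf Hq -> Hn; rewrite !(hits_edge_h R) by auto.
  replace (i + step s + step (negb s)) with i by (destruct s; simpl; lia).
  rewrite negb_involutive.
  assert (Eo := hor_opp eh i j s).
  assert (M : forall t, merges eh ev i j s t = false).
  { intros t; apply not_true_is_false; intros H; apply merge_take in H; tauto. }
  rewrite !M; clear M.
  pose proof (merge_gives_h R eh ev i j s true Hf Hq) as G1.
  pose proof (merge_gives_h R eh ev i j s false Hf Hq) as G0.
  destruct (hor eh i j s) eqn:E; [|clear Hn|easy]; simpl in Eo.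
  - assert (N1 : forall t, gives_h eh ev i j s t = false)
      by (intros; unfold gives_h, give; now rewrite E).
    assert (N2 : forall t, gives_h eh ev (i + step s) j (negb s) t = false)
      by (intros; unfold gives_h, give; now rewrite Eo).
    rewrite !N1, !N2; reflexivity.
  (* The receiver contributes both of its cells or neither, according to whether it merges at an end
     of this side. *)
  - assert (N2 : forall t, gives_h eh ev (i + step s) j (negb s) t =
      negb (merges eh ev (i + step s) j (negb s) true || merges eh ev (i + step s) j (negb s) false))
      by (intros; unfold gives_h, give; now rewrite Eo).
    rewrite !N2.
    assert (C : gives_h eh ev i j s false = negb (gives_h eh ev i j s true))
      by (apply give_side_count, E).
    rewrite C in *.
    assert (U : merges eh ev (i + step s) j (negb s) true = true ->
                merges eh ev (i + step s) j (negb s) false = false) by apply merge_unique.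
    destruct (merges eh ev (i + step s) j (negb s) true),
      (merges eh ev (i + step s) j (negb s) false), (gives_h eh ev i j s true);
      simpl in *; intuition discriminate.
Qed.

Lemma edge_count_v (R : list cell) (eh ev : Z -> Z -> Z) (i j j' : Z) (t : bool) :
  unit_flow R eh ev -> sparse eh ev -> j' = j + step t -> ver ev i j t <> Take ->
  zero_or_three (hits eh ev i j false t false true) (hits eh ev i j true t false true)
    (hits eh ev i j' false (negb t) false true) (hits eh ev i j' true (negb t) false true) = true.
Proof.
  intros Hf Hq -> Hn; rewrite !(hits_edge_v R) by auto.
  replace (j + step t + step (negb t)) with j by (destruct t; simpl; lia).
  rewrite negb_involutive.
  assert (Eo := ver_opp ev i j t).
  assert (M : forall s, merges eh ev i j s t = false).
  { intros s; apply not_true_is_false; intros H; apply merge_take in H; tauto. }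
  rewrite !M; clear M.
  pose proof (merge_gives_v R eh ev i j true t Hf Hq) as G1.
  pose proof (merge_gives_v R eh ev i j false t Hf Hq) as G0.
  destruct (ver ev i j t) eqn:E; [|clear Hn|easy]; simpl in Eo.
  - assert (N1 : forall s, gives_v eh ev i j s t = false)
      by (intros; unfold gives_v, give; now rewrite E).
    assert (N2 : forall s, gives_v eh ev i (j + step t) s (negb t) = false)
      by (intros; unfold gives_v, give; now rewrite Eo).
    rewrite !N1, !N2; reflexivity.
  - assert (N2 : forall s, gives_v eh ev i (j + step t) s (negb t) =
      negb (merges eh ev i (j + step t) true (negb t) || merges eh ev i (j + step t) false (negb t)))
      by (intros; unfold gives_v, give; now rewrite Eo, !(merge_swap (hor eh i (j + step t)) (ver ev i (j + step t)))).
    rewrite !N2.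
    assert (C : gives_v eh ev i j false t = negb (gives_v eh ev i j true t))
      by (apply give_side_count, E).
    rewrite C in *.
    assert (U : merges eh ev i (j + step t) true (negb t) = true ->
                merges eh ev i (j + step t) false (negb t) = false).
    { unfold merges; rewrite <- !(merge_swap (hor eh i (j + step t)) (ver ev i (j + step t)));
        apply merge_unique. }
    destruct (merges eh ev i (j + step t) true (negb t)),
      (merges eh ev i (j + step t) false (negb t)), (gives_v eh ev i j true t);
      simpl in *; intuition discriminate.
Qed.

(** Both neighbours comply with the merge, and sparsity leaves the two edges at the opposite block
    idle, so this block stays out. *)
Lemma merge_corner_hits (R : list cell) (eh ev : Z -> Z -> Z) (i i' j j' : Z) (s t : bool) :
  unit_flow R eh ev -> sparse eh ev -> i' = i + step s -> j' = j + step t ->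
  merges eh ev i j s t = true ->
  hits eh ev i j s t true true = true /\ hits eh ev i' j (negb s) t true true = true /\
  hits eh ev i j' s (negb t) true true = true /\
  hits eh ev i' j' (negb s) (negb t) true true = false.
Proof.
  intros Hf Hq -> -> Hm; rewrite !(hits_corner R) by auto.
  replace (i + step s + step (negb s)) with i by (destruct s; simpl; lia).
  replace (j + step t + step (negb t)) with j by (destruct t; simpl; lia).
  rewrite !negb_involutive, Hm.
  assert (Gh : gives_h eh ev (i + step s) j (negb s) t = true).
  { apply (merge_gives_h R); auto.
    replace (i + step s + step (negb s)) with i by (destruct s; simpl; lia).
    now rewrite negb_involutive. }
  assert (Gv : gives_v eh ev i (j + step t) s (negb t) = true).
  { apply (merge_gives_v R); auto.
    replace (j + step t + step (negb t)) with j by (destruct t; simpl; lia).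
    now rewrite negb_involutive. }
  rewrite Gh, Gv; simpl; rewrite !orb_true_r; simpl.
  pose proof (merge_take _ _ _ _ Hm) as [Eh Ev].
  pose proof (sparse_corner eh ev i j s t Hq) as H; rewrite Eh, Ev in H.
  assert (Fh : hor eh (i + step s) (j + step t) (negb s) = Idle).
  { rewrite hor_opp; destruct (hor eh i (j + step t) s); auto;
      destruct (ver ev (i + step s) j t); simpl in H; lia. }
  assert (Fv : ver ev (i + step s) (j + step t) (negb t) = Idle).
  { rewrite ver_opp; destruct (ver ev (i + step s) j t); auto;
      destruct (hor eh i (j + step t) s); simpl in H; lia. }
  repeat split; auto.
  unfold merges, gives_h, gives_v, merge, give; now rewrite Fh, Fv.
Qed.

Lemma corner_count (R : list cell) (eh ev : Z -> Z -> Z) (i j : Z) :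
  unit_flow R eh ev -> sparse eh ev ->
  zero_or_three (hits eh ev i j true true true true) (hits eh ev i (j + 1) true false true true)
    (hits eh ev (i + 1) j false true true true)
    (hits eh ev (i + 1) (j + 1) false false true true) = true.
Proof.
  intros Hf Hq.
  destruct (merges eh ev i j true true) eqn:M1.
  { destruct (merge_corner_hits R eh ev i (i + 1) j (j + 1) true true Hf Hq
      ltac:(simpl; lia) ltac:(simpl; lia) M1) as (H1 & H2 & H3 & H4).
    simpl in *; rewrite H1, H2, H3, H4; reflexivity. }
  destruct (merges eh ev i (j + 1) true false) eqn:M2.
  { destruct (merge_corner_hits R eh ev i (i + 1) (j + 1) j true false Hf Hq
      ltac:(simpl; lia) ltac:(simpl; lia) M2) as (H1 & H2 & H3 & H4).
    simpl in *; rewrite H1, H2, H3, H4; reflexivity. }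
  destruct (merges eh ev (i + 1) j false true) eqn:M3.
  { destruct (merge_corner_hits R eh ev (i + 1) i j (j + 1) false true Hf Hq
      ltac:(simpl; lia) ltac:(simpl; lia) M3) as (H1 & H2 & H3 & H4).
    simpl in *; rewrite H1, H2, H3, H4; reflexivity. }
  destruct (merges eh ev (i + 1) (j + 1) false false) eqn:M4.
  { destruct (merge_corner_hits R eh ev (i + 1) i (j + 1) j false false Hf Hq
      ltac:(simpl; lia) ltac:(simpl; lia) M4) as (H1 & H2 & H3 & H4).
    simpl in *; rewrite H1, H2, H3, H4; reflexivity. }
  rewrite !(hits_corner R) by auto; simpl.
  replace (i + 1 + -1) with i by lia; replace (j + 1 + -1) with j by lia.
  rewrite M1, M2, M3, M4, !andb_false_r; reflexivity.
Qed.

(** The window has lower left cell (2i+a, 2j+b), and (u,w) is a position in it. Adding [a] and [u]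
    in binary, the carry moves to the next block and the sum bit is the corner within that block. *)
Definition window_hits (eh ev : Z -> Z -> Z) (i j : Z) (a b u w : bool) : bool :=
  hits eh ev (i + Z.b2z (a && u)) (j + Z.b2z (b && w)) (xorb a u) (xorb b w) a b.

(** The parities [a] and [b] separate vertex, side and block windows. A block window requires
    membership in [R], since an idle block outside would keep all four cells. *)
Lemma window_count (R : list cell) (eh ev : Z -> Z -> Z) (i j : Z) (a b : bool) :
  unit_flow R eh ev -> sparse eh ev -> (a || b = false -> In (i, j) R) ->
  zero_or_three (window_hits eh ev i j a b false false) (window_hits eh ev i j a b false true)
    (window_hits eh ev i j a b true false) (window_hits eh ev i j a b true true) = true.
Proof.
  intros Hf Hq Hin; unfold window_hits.
  destruct a, b; simpl; rewrite ?Z.add_0_r.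
  - apply (corner_count R); auto.
  - destruct (hor eh i j true) eqn:E.
    1,2: apply (edge_count_h R eh ev i (i + 1) j true); auto; rewrite E; discriminate.
    pose proof (hor_opp eh i j true) as E'; rewrite E in E'; simpl in E'.
    (* Here (i,j) is the receiver, so the side is viewed from the giving block. *)
    rewrite zero_or_three_swap.
    apply (edge_count_h R eh ev (i + 1) i j false); auto; [simpl; lia | rewrite E'; discriminate].
  (* [window_hits] is listed column by column, [edge_count_v] block by block. *)
  - rewrite zero_or_three_middle; destruct (ver ev i j true) eqn:E.
    1,2: apply (edge_count_v R eh ev i j (j + 1) true); auto; rewrite E; discriminate.
    pose proof (ver_opp ev i j true) as E'; rewrite E in E'; simpl in E'.
    rewrite zero_or_three_swap.
    apply (edge_count_v R eh ev i (j + 1) j false); auto; [simpl; lia | rewrite E'; discriminate].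
  - rewrite !hits_block; apply own_count, (balanced_in R); auto.
Qed.

(** * Windows as a partition into trominoes *)

Lemma b2z_div (k : Z) (r : bool) : (2 * k + Z.b2z r) / 2 = k.
Proof. destruct r; simpl; Z.div_mod_to_equations; lia. Qed.

Lemma b2z_odd (k : Z) (r : bool) : Z.odd (2 * k + Z.b2z r) = r.
Proof. rewrite Z.add_comm, Z.odd_add_mul_2; now destruct r. Qed.

Lemma window_b2z (eh ev : Z -> Z -> Z) (i j : Z) (s t : bool) :
  window eh ev (2 * i + Z.b2z s, 2 * j + Z.b2z t) =
  (2 * i + (if leaves_h eh ev i j s t then step s else 0),
   2 * j + (if leaves_v eh ev i j s t then step t else 0)).
Proof.
  unfold window; cbn [fst snd]; now rewrite !b2z_div, !b2z_odd.
Qed.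

Lemma b2z_decomp (x : Z) : exists k r, x = 2 * k + Z.b2z r.
Proof.
  exists (x / 2), (Z.odd x); pose proof (Zmod_odd x).
  destruct (Z.odd x); simpl; Z.div_mod_to_equations; lia.
Qed.

Lemma window_hits_iff (eh ev : Z -> Z -> Z) (i j : Z) (a b u w : bool) :
  window eh ev (2 * i + Z.b2z a + Z.b2z u, 2 * j + Z.b2z b + Z.b2z w) =
    (2 * i + Z.b2z a, 2 * j + Z.b2z b) <-> window_hits eh ev i j a b u w = true.
Proof.
  assert (E : forall k x y, 2 * k + Z.b2z x + Z.b2z y = 2 * (k + Z.b2z (x && y)) + Z.b2z (xorb x y))
    by (intros k [] []; simpl; lia).
  rewrite !E, window_b2z; unfold window_hits, hits.
  rewrite andb_true_iff, !eqb_true_iff, cell_eq_iff.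
  destruct (leaves_h _ _ _ _ _ _), (leaves_v _ _ _ _ _ _), a, b, u, w; simpl;
    split; intros []; split; try discriminate; try lia; reflexivity.
Qed.

Lemma window_in_block (eh ev : Z -> Z -> Z) (c : cell) :
  in_block (fst (window eh ev c)) (snd (window eh ev c)) c.
Proof.
  destruct c as [x y]; destruct (b2z_decomp x) as (i & s & ->), (b2z_decomp y) as (j & t & ->).
  rewrite window_b2z; unfold in_block; simpl.
  destruct (leaves_h _ _ _ _ _ _), (leaves_v _ _ _ _ _ _), s, t; simpl; lia.
Qed.

Lemma leaves_in (R : list cell) (eh ev : Z -> Z -> Z) (i j : Z) (s t : bool) :
  supported R eh ev ->
  leaves_h eh ev i j s t = true \/ leaves_v eh ev i j s t = true -> In (i, j) R.
Proof.
  intros Hs H.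
  destruct (hor eh i j s) eqn:Eh.
  2,3: apply (hor_in R eh ev i j s Hs); congruence.
  destruct (ver ev i j t) eqn:Ev.
  2,3: apply (ver_in R eh ev i j t Hs); congruence.
  unfold leaves_h, leaves_v, gives_h, gives_v, merges, merge, give in H.
  rewrite Eh, Ev in H; simpl in H; destruct H; discriminate.
Qed.

(** A cell that leaves its block has an active side, hence lies over [R]. Otherwise its window is
    its own block, and parity puts [c] in that block. *)
Lemma window_subdiv (R : list cell) (eh ev : Z -> Z -> Z) (c d : cell) :
  supported R eh ev -> subdiv R c -> window eh ev d = window eh ev c -> subdiv R d.
Proof.
  intros Hs; destruct c as [x y], d as [x' y'].
  destruct (b2z_decomp x) as (i & s & ->), (b2z_decomp y) as (j & t & ->).
  destruct (b2z_decomp x') as (i' & s' & ->), (b2z_decomp y') as (j' & t' & ->).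
  rewrite !subdiv_iff, !b2z_div, !window_b2z, cell_eq_iff; intros Hin [E1 E2].
  destruct (leaves_h eh ev i' j' s' t') eqn:L1; [apply (leaves_in R eh ev i' j' s' t'); auto|].
  destruct (leaves_v eh ev i' j' s' t') eqn:L2; [apply (leaves_in R eh ev i' j' s' t'); auto|].
  replace i' with i by (destruct (leaves_h eh ev i j s t), s; simpl in *; lia).
  replace j' with j by (destruct (leaves_v eh ev i j s t), t; simpl in *; lia).
  exact Hin.
Qed.

Lemma window_class_tromino (R : list cell) (eh ev : Z -> Z -> Z) (c : cell) :
  unit_flow R eh ev -> sparse eh ev -> subdiv R c ->
  is_L_tromino (fun d => subdiv R d /\ window eh ev d = window eh ev c).
Proof.
  intros Hf Hq Hc.
  destruct (window eh ev c) as [A B] eqn:EW.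
  destruct (b2z_decomp A) as (i & a & ->), (b2z_decomp B) as (j & b & ->).
  assert (Hblock : forall x y, in_block (2 * i + Z.b2z a) (2 * j + Z.b2z b) (x, y) ->
    exists u w, x = 2 * i + Z.b2z a + Z.b2z u /\ y = 2 * j + Z.b2z b + Z.b2z w).
  { intros x y [Hx Hy]; simpl in Hx, Hy.
    exists (negb (x =? 2 * i + Z.b2z a)), (negb (y =? 2 * j + Z.b2z b)).
    destruct (Z.eqb_spec x (2 * i + Z.b2z a)), (Z.eqb_spec y (2 * j + Z.b2z b)); simpl; lia. }
  assert (Hin : a || b = false -> In (i, j) R).
  { intros Hab; apply orb_false_iff in Hab as [-> ->]; simpl in EW.
    destruct c as [x y]; apply subdiv_iff in Hc.
    destruct (b2z_decomp x) as (k & s & ->), (b2z_decomp y) as (l & t & ->).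
    rewrite window_b2z in EW; apply cell_eq_iff in EW as [E1 E2].
    rewrite !b2z_div in Hc.
    replace i with k by (destruct (leaves_h eh ev k l s t), s; simpl in *; lia).
    replace j with l by (destruct (leaves_v eh ev k l s t), t; simpl in *; lia).
    exact Hc. }
  pose proof (window_count R eh ev i j a b Hf Hq Hin) as Hcount.
  (* The window of [c] is hit by [c] itself, so the count is three rather than zero; (u0,w0) is the
     one position missed. *)
  assert (Hm : exists u0 w0, forall u w,
    window_hits eh ev i j a b u w = negb (Bool.eqb u u0 && Bool.eqb w w0)).
  { assert (Hhit : exists u w, window_hits eh ev i j a b u w = true).
    { pose proof (window_in_block eh ev c) as Hb; rewrite EW in Hb; destruct c as [x y].
      destruct (Hblock x y Hb) as (u & w & -> & ->).
      exists u, w; now apply window_hits_iff. }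
    destruct Hhit as (u & w & Huw).
    destruct (window_hits eh ev i j a b false false) eqn:H00,
      (window_hits eh ev i j a b false true) eqn:H01,
      (window_hits eh ev i j a b true false) eqn:H10,
      (window_hits eh ev i j a b true true) eqn:H11; try discriminate Hcount;
      [exists true, true | exists true, false | exists false, true | exists false, false |
       destruct u, w; congruence].
    all: intros [] []; assumption. }
  destruct Hm as (u0 & w0 & Hm).
  exists (2 * i + Z.b2z a), (2 * j + Z.b2z b),
    (2 * i + Z.b2z a + Z.b2z u0, 2 * j + Z.b2z b + Z.b2z w0).
  split; [unfold in_block; destruct u0, w0; simpl; lia|].
  intros [x y]; split.
  - intros [_ Hw].
    pose proof (window_in_block eh ev (x, y)) as Hb; rewrite Hw in Hb; split; [exact Hb|].
    intros E; rewrite E in Hw; apply window_hits_iff in Hw.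
    rewrite Hm, !eqb_reflx in Hw; discriminate.
  - intros [Hb Hne]; destruct (Hblock x y Hb) as (u & w & -> & ->).
    assert (Hw : window eh ev (2 * i + Z.b2z a + Z.b2z u, 2 * j + Z.b2z b + Z.b2z w) =
      (2 * i + Z.b2z a, 2 * j + Z.b2z b)).
    { apply window_hits_iff; rewrite Hm; apply negb_true_iff, not_true_is_false.
      rewrite andb_true_iff, !eqb_true_iff; intros [-> ->]; auto. }
    split; [|exact Hw].
    apply (window_subdiv R eh ev c); [apply Hf | exact Hc | congruence].
Qed.

Theorem theorem7 (R : list cell) (HR : is_region R) :
  has_cover (subdiv R) <-> Nat.divide 3 (length R).
Proof.
  split.
  - apply cover_divides, HR.
  - intros Hd; destruct (sparse_unit_flow_exists R HR Hd) as (eh & ev & Hf & Hq).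
    apply (cover_of_key R (window eh ev)); intros c Hc.
    exact (window_class_tromino R eh ev c Hf Hq Hc).
Qed.
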